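(* Let $\overline{Q}(t,z)=\sum_{n\ge0}\overline{Q}_n(t)\frac{z^n}{n!}$, where $\overline{Q}_n(t)=\sum_{\pi}t^{\operatorname{des}(\pi)}$, the sum ranging over all quasi-Stirling permutations $\pi$ of size $n$ (so $\overline{Q}_0(t)=1$). Let $A(t,z)=\sum_{n\ge0}A_n(t)\frac{z^n}{n!}=\frac{1-t}{1-te^{(1-t)z}}$, where $A_n(t)=\sum_{\sigma\in S_n}t^{\operatorname{des}(\sigma)}$ are the Eulerian polynomials ($A_0(t)=1$). Then $\overline{Q}(t,z)=A(t,z\overline{Q}(t,z))$, that is, $$\overline{Q}(t,z)=\frac{1-t}{1-t\,e^{(1-t)z\overline{Q}(t,z)}}.$$ In particular, for all $n\ge0$, $$\overline{Q}_n(t)=\frac{n!}{n+1}\,[z^n]A(t,z)^{n+1}.$$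
   Context: A quasi-Stirling permutation of size $n$ is a permutation $\pi_1\cdots\pi_{2n}$ of the multiset $\{1,1,2,2,\dots,n,n\}$ with no indices $i<j<k<\ell$ such that $\pi_i=\pi_k$ and $\pi_j=\pi_\ell$; for $n=0$ there is only the empty permutation. For a sequence $\pi_1\cdots\pi_r$, an index $i\in\{1,\dots,r\}$ is a descent if $\pi_i>\pi_{i+1}$ or $i=r$, and $\operatorname{des}$ counts descents. $S_n$ is the set of permutations of $\{1,\dots,n\}$. $[z^n]F(z)$ denotes the coefficient of $z^n$ in $F$. *)

(* Defs.v *)
(* Formal power series in z over the ring {poly rat} (t = 'X). *)
From HB Require Import structures.
From mathcomp Require Import all_boot all_order all_algebra all_fingroup.
Set Implicit Arguments. Unset Strict Implicit. Unset Printing Implicit Defensive.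
Import Order.TTheory GRing.Theory Num.Theory.
Local Open Scope ring_scope.

(* number of descents: index i (1-based) is a descent if pi_i > pi_{i+1} or i = r.
   With 0-based indices i < size s: s_i > s_{i+1} or i+1 = size s. *)
Definition des (s : seq nat) : nat :=
  (\sum_(i < size s) ((nth 0 s i > nth 0 s i.+1) || (i.+1 == size s)))%N.

Definition stirling_multiset (n : nat) : seq nat :=
  flatten [seq [:: i; i] | i <- iota 1 n].

Definition no_1212 (s : seq nat) : bool :=
  [forall i : 'I_(size s), forall j : 'I_(size s), forall k : 'I_(size s),
     forall l : 'I_(size s),
     ~~ [&& (i < j)%N, (j < k)%N, (k < l)%N,
            nth 0 s i == nth 0 s k & nth 0 s j == nth 0 s l]].

Definition quasi_stirling (n : nat) (s : seq nat) : bool :=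
  perm_eq s (stirling_multiset n) && no_1212 s.

(* \overline{Q}_n(t) : sum over quasi-Stirling permutations of size n of t^des.
   Such permutations are enumerated as (2n)-tuples with entries in {0..n}
   (the entry 0 never occurs, by the multiset condition). *)
Definition Qbar (n : nat) : {poly rat} :=
  \sum_(w : (2 * n).-tuple 'I_n.+1 | quasi_stirling n (map val w)) 'X^(des (map val w)).

Definition eulerian (n : nat) : {poly rat} :=
  \sum_(s : {perm 'I_n}) 'X^(des [seq (val (s i)).+1 | i <- enum 'I_n]).

Definition series := nat -> {poly rat}.

Definition sone : series := fun n => (n == 0%N)%:R.
Definition smul (F G : series) : series :=
  fun n => \sum_(i < n.+1) F i * G (n - i)%N.
Definition spow (F : series) (k : nat) : series := iter k (smul F) sone.
Definition szmul (F : series) : series :=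
  fun n => if n is m.+1 then F m else 0.
Definition sscale (c : {poly rat}) (F : series) : series := fun n => c * F n.
(* composition  sum_k a_k G^k, for G with zero constant term *)
Definition scomp (a : series) (G : series) : series :=
  fun n => \sum_(k < n.+1) a k * spow G k n.
(* exponential e^G, for G with zero constant term *)
Definition sexp (G : series) : series :=
  scomp (fun k => ((k`!%:R : rat)^-1)%:P) G.
Definition egf (P : nat -> {poly rat}) : series :=
  fun n => (n`!%:R : rat)^-1 *: P n.

Definition Qser : series := egf Qbar.
Definition Aser : series := egf eulerian.

(* Main.v *)
(** Cut a quasi-Stirling permutation into top-level blocks,
    pi = a1 r1 a1 a2 r2 a2 ... ak rk ak; then des pi is des (a1 ... ak) plus the
    numbers of descents inside the words ai ri ai.  Moving the letters above a
    below the letters under a turns the descents of a r a into the descents of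
    r, so summing over r makes each block contribute Q_|r|, whatever its label a.

    Let G_c be the weighted sum over block sequences preceded by the label c, in
    the algebra of set functions under subset convolution, and let w_a be the
    weight of all blocks with label a, so that w_a^2 = 0.  Then
    G_(a+1) = (1 + (t - 1) w_a) G_a, and comparing both ends gives
    (1 - t E) G_0 = 1 - t with E = prod_a (1 + (1 - t) w_a)
    = exp ((1 - t) sum_a w_a), where sum_a w_a corresponds to z Q.
    With all blocks of the form a a this is the closed form of A(t,z), and the
    two equations together yield Q = A(t, z Q); the coefficient formula is then
    Lagrange inversion.  Power series are handled as polynomials compared up to
    a given degree. *)
Require Import Defs.
From HB Require Import structures.
From mathcomp Require Import all_boot all_order all_algebra all_fingroup.
From mathcomp Require Import ring zify.
Import Order.TTheory GRing.Theory Num.Theory.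
Set Implicit Arguments.
Unset Strict Implicit.
Unset Printing Implicit Defensive.
Local Open Scope ring_scope.

(** * Truncated power series and Lagrange inversion *)

Section Truncation.
Variable R : comNzRingType.
Implicit Types (p q r : {poly R}) (n : nat).

(** Congruence modulo ['X^n.+1]: any polynomial in the class stands for the power series up to order
    [n]. *)
Definition eqtrunc n p q := forall i, (i <= n)%N -> p`_i = q`_i.

Lemma eqtrunc_sym n p q : eqtrunc n p q -> eqtrunc n q p.
Proof. by move=> h i hi; rewrite h. Qed.

Lemma eqtrunc_trans n q p r : eqtrunc n p q -> eqtrunc n q r -> eqtrunc n p r.
Proof. by move=> h1 h2 i hi; rewrite h1 // h2. Qed.

Lemma eqtruncW n m p q : (m <= n)%N -> eqtrunc n p q -> eqtrunc m p q.
Proof. by move=> mn h i hi; apply: h; apply: leq_trans mn. Qed.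

Lemma eqtruncD n p p' q q' :
  eqtrunc n p p' -> eqtrunc n q q' -> eqtrunc n (p + q) (p' + q').
Proof. by move=> h1 h2 i hi; rewrite !coefD h1 // h2. Qed.

Lemma eqtruncN n p p' : eqtrunc n p p' -> eqtrunc n (- p) (- p').
Proof. by move=> h1 i hi; rewrite !coefN h1. Qed.

Lemma eqtruncM n p p' q q' :
  eqtrunc n p p' -> eqtrunc n q q' -> eqtrunc n (p * q) (p' * q').
Proof.
move=> h1 h2 i hi; rewrite !coefM; apply: eq_bigr => j _.
by rewrite h1 ?h2 //; move: (ltn_ord j); lia.
Qed.

Lemma eqtruncX n p p' k : eqtrunc n p p' -> eqtrunc n (p ^+ k) (p' ^+ k).
Proof.
by move=> h; elim: k => [|k IH] //; rewrite !exprS; apply: eqtruncM.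
Qed.

Lemma coef_exp_small p k i : p`_0 = 0 -> (i < k)%N -> (p ^+ k)`_i = 0.
Proof.
move=> p0; elim: k i => // k IH i ik; rewrite exprS coefM big1 // => -[j /=].
rewrite ltnS => ji _; case: j ji => [|j] ji; first by rewrite p0 mul0r.
by rewrite IH ?mulr0 //; lia.
Qed.

(** As [q] has no constant term, [q ^+ k] starts in degree [k], so only [k <= n] matter; this is the
    shape of [scomp]. *)
Lemma coef_comp_trunc p q n :
  q`_0 = 0 -> (p \Po q)`_n = \sum_(k < n.+1) p`_k * (q ^+ k)`_n.
Proof.
move=> q0; rewrite coef_comp_poly.
rewrite -(big_mkord xpredT (fun k => p`_k * (q ^+ k)`_n)).
rewrite -[RHS](big_mkord xpredT (fun k => p`_k * (q ^+ k)`_n)).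
pose m := maxn (size p) n.+1.
rewrite [LHS](big_nat_widen _ _ m) ?leq_maxl //.
rewrite [RHS](big_nat_widen _ _ m) ?leq_maxr //.
rewrite big_mkcond [RHS]big_mkcond /=; apply: eq_bigr => k _ /=.
case: ltnP => hk; case: ltnP => hk' //.
  by rewrite coef_exp_small ?mulr0.
by rewrite nth_default ?mul0r.
Qed.

Lemma eqtrunc_comp n p p' q :
  q`_0 = 0 -> eqtrunc n p p' -> eqtrunc n (p \Po q) (p' \Po q).
Proof.
move=> q0 h i hi; rewrite !coef_comp_trunc //; apply: eq_bigr => k _.
by rewrite h //; move: (ltn_ord k); lia.
Qed.

Lemma eqtrunc_regI n p q r :
  GRing.lreg r`_0 -> eqtrunc n (r * p) (r * q) -> eqtrunc n p q.
Proof.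
move=> reg h i; elim/ltn_ind: i => i IH hi.
have := h i hi; rewrite !coefM !big_ord_recl /= subn0.
under eq_bigr => j _.
  rewrite (IH (i - bump 0 j)%N); [|rewrite /bump; case: i {IH hi} j => [[]|i j] //; lia|lia].
  over.
by move/addIr/reg.
Qed.

(** Geometric series in [1 - p], whose constant term vanishes. *)
Lemma eqtrunc_inv n p : p`_0 = 1 -> {q | eqtrunc n (q * p) 1}.
Proof.
move=> p0; exists (\sum_(k < n.+1) (1 - p) ^+ k).
have -> : (\sum_(k < n.+1) (1 - p) ^+ k) * p = 1 - (1 - p) ^+ n.+1.
  by rewrite -[RHS]opprB subrX1; ring.
move=> i hi; rewrite coefB (@coef_exp_small (1 - p)) ?subr0 //.
by rewrite coefB coef1 p0 subrr.
Qed.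

End Truncation.

Section Lagrange.
Variable R : comNzRingType.
Hypothesis mulrIn : forall m, (0 < m)%N -> injective (fun x : R => x *+ m).
Implicit Types (p q A P Q : {poly R}) (n : nat).

(** The operator z d/dz. Unlike the derivative it preserves degrees, so no order of truncation is
    lost; [Q + D Q] is the derivative of zQ. *)
Definition euler_deriv p := 'X * p^`().
Local Notation D := euler_deriv.

Lemma coef_euler_deriv p n : (D p)`_n = p`_n *+ n.
Proof. by rewrite /euler_deriv coefXM; case: n => [|n]; rewrite ?mulr0n ?coef_deriv. Qed.

Lemma euler_derivM p q : D (p * q) = D p * q + p * D q.
Proof. by rewrite /euler_deriv derivM mulrDr mulrA mulrCA. Qed.

Lemma euler_derivX p k : D (p ^+ k.+1) = (p ^+ k * D p) *+ k.+1.
Proof. by rewrite /euler_deriv deriv_exp /= mulrnAr; congr (_ *+ _); ring. Qed.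

Lemma eqtrunc_euler n p q : eqtrunc n p q -> eqtrunc n (D p) (D q).
Proof. by move=> h i hi; rewrite !coef_euler_deriv h. Qed.

(** This is the residue of (zQ)' / (zQ)^(m+1): for [m > 0] the integrand is a derivative and the
    residue is 0, for [m = 0] it is a logarithmic derivative with residue 1. *)
Lemma residue m P Q : Q`_0 = 1 -> eqtrunc m (P * Q) 1 ->
  (P ^+ m.+1 * (Q + D Q))`_m = (m == 0%N)%:R.
Proof.
move=> Q0 PQ; case: m PQ => [|m] PQ.
  have := PQ 0%N isT; rewrite !coef0M Q0 mulr1 coef1 expr1 => ->.
  by rewrite coefD coef_euler_deriv Q0 mul1r mulr0n addr0.
have h0 : eqtrunc m.+1 (P ^+ m.+2 * (Q + D Q)) (P ^+ m.+1 - P ^+ m * D P).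
  (* [D Q] is eliminated by [P * D Q = D (P * Q) - D P * Q]; then [Q] occurs only in [P * Q], which
     is 1 to this order. *)
  have -> : P ^+ m.+2 * (Q + D Q) =
      P ^+ m.+1 * (P * Q) + P ^+ m.+1 * D (P * Q) - P ^+ m * D P * (P * Q).
    by rewrite euler_derivM !exprS; ring.
  have -> : P ^+ m.+1 - P ^+ m * D P =
      P ^+ m.+1 * 1 + P ^+ m.+1 * D 1 - P ^+ m * D P * 1.
    by rewrite [D 1]/euler_deriv derivC mulr0 mulr0 !mulr1 addr0.
  apply: eqtruncD; last by apply: eqtruncN; apply: eqtruncM.
  by apply: eqtruncD; apply: eqtruncM => //; apply: eqtrunc_euler.
rewrite h0 // coefB /=; apply/eqP; rewrite subr_eq0; apply/eqP.
(* Multiplied by [m.+1], both sides are the coefficient of [D (P ^+ m.+1)] in degree [m.+1]. *)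
apply: (mulrIn (ltn0Sn m)); rewrite /= -coef_euler_deriv euler_derivX.
by rewrite coefMn.
Qed.

(* The formal residue argument: multiply Q^(n+1) = sum_k h_k z^k Q^k by
   (zQ)' Q^(-n-1) and extract the coefficient of z^n. *)
Lemma lagrange_inversion n A Q :
  Q`_0 = 1 -> eqtrunc n Q (A \Po ('X * Q)) ->
  Q`_n *+ n.+1 = (A ^+ n.+1)`_n.
Proof.
move=> Q0 QA; have [P PQ] := eqtrunc_inv n Q0.
have XQ0 : ('X * Q)`_0 = 0 by rewrite coefXM.
have -> : Q`_n *+ n.+1 = (Q ^+ n.+1 * (P ^+ n.+1 * (Q + D Q)))`_n.
  have h : eqtrunc n (Q ^+ n.+1 * (P ^+ n.+1 * (Q + D Q))) (Q + D Q).
    rewrite mulrA -exprMn.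
    suff: eqtrunc n ((Q * P) ^+ n.+1 * (Q + D Q)) (1 ^+ n.+1 * (Q + D Q)).
      by rewrite expr1n mul1r.
    by apply: eqtruncM => //; apply: eqtruncX; rewrite mulrC.
  by rewrite h // coefD coef_euler_deriv mulrS.
set Z := P ^+ _ * _.
have h : eqtrunc n (Q ^+ n.+1 * Z) ((A ^+ n.+1 \Po ('X * Q)) * Z).
  by apply: eqtruncM => //; rewrite rmorphXn; apply: eqtruncX.
rewrite h // comp_polyE mulr_suml coef_sum.
set H := A ^+ n.+1.
(* Only [k = n] survives: ['X ^+ k] lowers the order to [m = n - k], and [Q ^+ k] cancels [k] of the
   factors [P], leaving the residue of order [m]. *)
have tE k : ((H`_k *: ('X * Q) ^+ k) * Z)`_n = H`_k * (k == n)%:R.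
  rewrite -scalerAl coefZ exprMn -mulrA coefXnM; congr (_ * _).
  case: ltnP => hk; first by rewrite gtn_eqF.
  set m := (n - k)%N; have -> : (k == n) = (m == 0%N) by rewrite /m; lia.
  have PQm : eqtrunc m (P * Q) 1 by apply: eqtruncW PQ; rewrite leq_subr.
  rewrite -(residue Q0 PQm).
  have -> : Q ^+ k * Z = (P * Q) ^+ k * (P ^+ m.+1 * (Q + D Q)).
    rewrite /Z exprMn (_ : n.+1 = k + m.+1)%N ?exprD; last by rewrite /m; lia.
    by ring.
  have h' : eqtrunc m ((P * Q) ^+ k * (P ^+ m.+1 * (Q + D Q)))
     (1 ^+ k * (P ^+ m.+1 * (Q + D Q))).
    by apply: eqtruncM => //; apply: eqtruncX.
  by rewrite h' // expr1n mul1r.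
under eq_bigr => k _ do rewrite tE.
have [hn|hn] := ltnP n (size H).
  rewrite (bigD1 (Ordinal hn)) //= eqxx mulr1 big1 ?addr0 // => k.
  by rewrite -val_eqE /= => /negbTE ->; rewrite mulr0.
rewrite [RHS]nth_default // big1 // => k _.
by case: eqP => [hk|]; [move: (ltn_ord k); lia|rewrite mulr0].
Qed.

End Lagrange.

(** * Set functions under subset convolution *)

(** The alias carries subset convolution as its product instead of the pointwise one. *)
Definition set_alg (T : finType) (R : comNzRingType) : Type := {ffun {set T} -> R}.

Section SetAlgebra.
Variables (T : finType) (R : comNzRingType).
Implicit Types (F G H : set_alg T R) (S U V : {set T}).

HB.instance Definition _ := GRing.Zmodule.copy (set_alg T R) {ffun {set T} -> R}.

Definition set_one : set_alg T R := [ffun S => (S == set0)%:R].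
Definition set_mul F G : set_alg T R :=
  [ffun S : {set T} => \sum_(U : {set T} | U \subset S) F U * G (S :\: U)].

Lemma set_mulC : commutative set_mul.
Proof.
move=> F G; apply/ffunP => S; rewrite !ffunE.
rewrite (reindex_onto (fun U => S :\: U) (fun U => S :\: U)) /=; last first.
  by move=> U /setIidPr US; rewrite setDDr setDv set0U.
apply: eq_big => U.
  rewrite subsetDl setDDr setDv set0U /=.
  by apply/eqP/idP => [/setIidPr|/setIidPr].
rewrite setDDr setDv set0U => /andP[_ /eqP US].
by rewrite US mulrC.
Qed.

Lemma set_mulA : associative set_mul.
Proof.
move=> F G H; apply/ffunP => S; rewrite !ffunE.
under eq_bigr => U _ do rewrite ffunE big_distrr /=.
under [RHS]eq_bigr => U _ do rewrite ffunE big_distrl /=.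
rewrite [RHS](exchange_big_dep (fun U => U \subset S)) /=; last first.
  by move=> V U VS UV; apply: subset_trans UV VS.
apply: eq_bigr => U US.
(* Both sides sum over the ordered splittings of [S] into three disjoint parts; here the outer set
   is the union of the first two. *)
rewrite [RHS](reindex_onto (fun V => U :|: V) (fun V => V :\: U)) /=; last first.
  by move=> V /andP[_ UV]; rewrite setDE setUIr setUCr setIT; apply/setUidPr.
apply: eq_big => V.
  rewrite subUset US subsetUl /= andbT setDUl setDv set0U subsetD.
  by congr (_ && _); apply/idP/eqP => /setDidPl.
rewrite subsetD => /andP[_ /setDidPl VU]; rewrite setDUl setDv set0U VU.
by rewrite mulrA setDDl.
Qed.

Lemma set_mul1 : left_id set_one set_mul.
Proof.
move=> F; apply/ffunP => S; rewrite !ffunE (bigD1 set0) ?sub0set //=.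
rewrite ffunE eqxx mul1r setD0 big1 ?addr0 // => U /andP[_ /negbTE U0].
by rewrite ffunE U0 mul0r.
Qed.

Lemma set_mulDl : left_distributive set_mul +%R.
Proof.
move=> F G H; apply/ffunP => S; rewrite !ffunE -big_split /=.
by apply: eq_bigr => U _; rewrite ffunE mulrDl.
Qed.

Lemma set_one_neq0 : set_one != 0.
Proof.
apply/eqP => /ffunP /(_ set0); rewrite !ffunE eqxx.
by apply/eqP/oner_neq0.
Qed.

HB.instance Definition _ := GRing.Zmodule_isComNzRing.Build (set_alg T R)
  set_mulA set_mulC set_mul1 set_mulDl set_one_neq0.

Lemma set_algM F G S :
  (F * G) S = \sum_(U : {set T} | U \subset S) F U * G (S :\: U).
Proof. by rewrite [LHS]ffunE. Qed.

Lemma set_alg1 S : (1 : set_alg T R) S = (S == set0)%:R.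
Proof. by rewrite [LHS]ffunE. Qed.

Lemma set_algD F G S : (F + G) S = F S + G S.
Proof. by rewrite [LHS]ffunE. Qed.

Lemma set_alg_sum (I : Type) (r : seq I) (P : pred I) (f : I -> set_alg T R) S :
  (\sum_(i <- r | P i) f i) S = \sum_(i <- r | P i) f i S.
Proof.
by elim/big_rec2: _ => [|i x y _ <-]; rewrite ?ffunE // set_algD.
Qed.

(* On functions of the cardinality, subset convolution is the product of
   exponential generating functions. *)
Definition egf_set (p : {poly R}) : set_alg T R :=
  [ffun S : {set T} => p`_#|S| *+ #|S|`!].

Lemma egf_set_is_zmod : zmod_morphism egf_set.
Proof. by move=> p q; apply/ffunP => S; rewrite !ffunE coefB mulrnBl. Qed.

Lemma sum_subsets_card S (f : nat -> R) :
  \sum_(U : {set T} | U \subset S) f #|U| =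
  \sum_(i < #|S|.+1) f i *+ 'C(#|S|, i).
Proof.
rewrite (partition_big (fun U => inord #|U| : 'I_#|S|.+1) xpredT) //=.
apply: eq_bigr => i _; rewrite -cards_draws -sumr_const.
have iE U : U \subset S -> (inord #|U| == i) = (#|U| == i).
  by move=> US; rewrite -val_eqE /= inordK // ltnS subset_leq_card.
apply: eq_big => U; first by rewrite inE; case: (boolP (U \subset S)) => //= /iE.
by case/andP => US; rewrite iE // => /eqP ->.
Qed.

Lemma egf_set_is_monoid : monoid_morphism egf_set.
Proof.
split=> [|p q]; apply/ffunP => S.
  by rewrite !ffunE coef1 cards_eq0; case: eqP => [->|]; rewrite ?cards0 ?mul0rn.
rewrite set_algM ffunE coefM -sumrMnl.
pose f i := (p`_i *+ i`!) * (q`_(#|S| - i) *+ (#|S| - i)`!).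
transitivity (\sum_(U : {set T} | U \subset S) f #|U|); last first.
  apply: eq_bigr => U US; rewrite !ffunE /f.
  by rewrite cardsD (setIidPr US).
rewrite sum_subsets_card; apply: eq_bigr => i _; rewrite /f.
rewrite mulrnAl mulrnAr -!mulrnA; congr (_ *+ _).
by rewrite -(@bin_fact #|S| i) ?leq_ord //; lia.
Qed.

HB.instance Definition _ := GRing.isZmodMorphism.Build _ _ egf_set egf_set_is_zmod.
HB.instance Definition _ := GRing.isMonoidMorphism.Build _ _ egf_set egf_set_is_monoid.

Lemma egf_setE p S : egf_set p S = p`_#|S| *+ #|S|`!.
Proof. by rewrite ffunE. Qed.

Lemma egf_setC_mul c F S : (egf_set c%:P * F) S = c * F S.
Proof.
rewrite set_algM (bigD1 set0) ?sub0set //= egf_setE cards0 coefC /= setD0.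
rewrite big1 ?addr0 ?mulr1n // => U /andP[_ U0].
by rewrite egf_setE coefC cards_eq0 (negbTE U0) mul0rn mul0r.
Qed.

(** The weight of all blocks with label [a]: [U] is the set of letters of the block, and [q] weighs
    its interior, which lacks [a]. *)
Definition rooted_weight (q : nat -> R) (a : T) : set_alg T R :=
  [ffun U : {set T} => (a \in U)%:R * q #|U|.-1].

(** Two disjoint sets cannot both contain [a]. *)
Lemma rooted_weight_sqr q a : rooted_weight q a ^+ 2 = 0.
Proof.
apply/ffunP => S; rewrite expr2 set_algM [RHS]ffunE big1 // => U _.
by rewrite !ffunE !inE; case: (a \in U); rewrite ?mul0r ?mulr0 //= mul0r mulr0.
Qed.

(** Any of the [#|S|] elements may be the root; for exponential generating functions this is
    multiplication by z. *)
Lemma sum_rooted_weight q S :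
  (\sum_a rooted_weight q a) S = q #|S|.-1 *+ #|S|.
Proof.
rewrite set_alg_sum -sumr_const [RHS]big_mkcond /=.
by apply: eq_bigr => a _; rewrite ffunE; case: (a \in S); rewrite ?mul1r ?mul0r.
Qed.

End SetAlgebra.

(** * Exponentials of sums of square-zero elements *)

Section NilpotentExponential.
Variables (A : comNzRingType) (iota : {rmorphism rat -> A}).

(** Each factor is exp of [w i], as [w i ^+ 2 = 0]. The nilpotency of the sum is carried through the
    induction, since it makes the exponential series stop at [size r]. *)
Lemma prod_1D_sqr0 (I : Type) (r : seq I) (w : I -> A) :
  (forall i, w i ^+ 2 = 0) ->
  (\sum_(i <- r) w i) ^+ (size r).+1 = 0 /\
  \prod_(i <- r) (1 + w i) =
  \sum_(k < (size r).+1) iota (k`!%:R)^-1 * (\sum_(i <- r) w i) ^+ k.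
Proof.
move=> w2; elim: r => [|i r [IH0 IH]].
  by rewrite !big_nil /= big_ord1 expr0 mulr1 invr1 rmorph1 expr0n.
rewrite !big_cons; set x := \sum_(j <- r) w j in IH0 IH *.
(* The binomial formula keeps just two terms. *)
have xw k : (w i + x) ^+ k.+1 = x ^+ k.+1 + (w i * x ^+ k) *+ k.+1.
  elim: k => [|k IHk]; first by rewrite !expr1 expr0 mulr1 addrC.
  rewrite exprS IHk mulrDl !mulrDr.
  have -> : w i * (w i * x ^+ k *+ k.+1) = 0.
    by rewrite -mulrnAr mulrA -expr2 w2 mul0r.
  rewrite -mulrnAr mulrCA mulrnAr -exprS [in RHS]mulrS -[x * _]exprS; ring.
split; first by rewrite xw exprS IH0 mulr0 add0r mulr0 mul0rn.
rewrite IH [in RHS]big_ord_recl.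
under [in RHS]eq_bigr => k _ do rewrite lift0 xw mulrDr.
rewrite [(ord0 : nat)`!]fact0 invr1 rmorph1 expr0 mulr1 big_split /= addrA mulrDl mul1r; congr (_ + _).
  rewrite big_ord_recl [(ord0 : nat)`!]fact0 invr1 rmorph1 expr0 mulr1; congr (_ + _).
  by rewrite [in RHS]big_ord_recr /= IH0 mulr0 addr0.
rewrite big_distrr /=; apply: eq_bigr => k _.
have -> : iota (k`!%:R)^-1 = iota (k.+1`!%:R)^-1 *+ k.+1.
  rewrite -rmorphMn /=; congr (iota _); rewrite factS natrM invfM.
  rewrite -[RHS]mulr_natl mulrA divff ?mul1r //.
  by rewrite pnatr_eq0.
by rewrite mulrnAr mulrnAl mulrnAr mulrCA.
Qed.

End NilpotentExponential.

(* [G c] is the weighted sum over sequences of labels that follow the label [c];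
   raising [c] by one past the label [a] multiplies it by [1 + (t - 1) w a]. *)
Lemma descent_transfer (A : comNzRingType) N (t : A) (w : 'I_N -> A) (G : nat -> A) :
  (forall a, w a ^+ 2 = 0) ->
  (forall c, G c = t ^+ (0 < c)%N +
     \sum_(a < N) t ^+ (a.+1 < c)%N * w a * G a.+1) ->
  (1 - t * \prod_(a < N) (1 + (1 - t) * w a)) * G 0%N = 1 - t.
Proof.
move=> w2 GE.
(* Labels are [a.+1], hence never below 0 or 1; the two values differ only in the empty sequence. *)
have G1 : G 1%N = G 0%N + t - 1.
  rewrite (GE 1%N) (GE 0%N) /= expr1 expr0; ring.
(* Every label, and also the closing 0, lies below [N.+1], so the first step is always a descent. *)
have GN : G N.+1 = t * G 0%N.
  rewrite (GE N.+1) (GE 0%N) /= expr1 expr0 mulrDr mulr1 big_distrr /=.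
  by congr (_ + _); apply: eq_bigr => a _; rewrite ltnS ltn_ord /= expr1 mul1r mulrA.
(* Only the term of [a] changes, gaining a factor [t]. *)
have GS (a : 'I_N) : G a.+2 = (1 + (t - 1) * w a) * G a.+1.
  rewrite (GE a.+2) mulrDl mul1r [X in _ = X + _](GE a.+1) /=.
  rewrite (bigD1 a) //= [in RHS](bigD1 a) //= !ltnS leqnn ltnn expr1 expr0 mul1r.
  rewrite (eq_bigr (fun b : 'I_N => t ^+ (b.+1 < a.+1)%N * w b * G b.+1)); last first.
    by move=> b /negbTE ba; rewrite !ltnS ltn_neqAle (inj_eq val_inj) ba.
  by ring.
have GP c : (c <= N)%N ->
    G c.+1 = (\prod_(a < N | (a < c)%N) (1 + (t - 1) * w a)) * G 1%N.
  elim: c => [|c IH] cN; first by rewrite big_pred0 // mul1r.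
  rewrite (GS (Ordinal cN)) /= IH; last exact: ltnW.
  rewrite [in RHS](bigD1 (Ordinal cN)) //= mulrA; congr (_ * _ * _).
  by apply: eq_bigl => a; rewrite -val_eqE /= ltnS [in RHS]leq_eqVlt; lia.
have := GP N (leqnn N); rewrite GN G1; under eq_bigl => a do rewrite ltn_ord.
set P := \prod_(a < N) (1 + (t - 1) * w a) => tG.
set E := \prod_(a < N) (1 + (1 - t) * w a).
(* The factors are inverse to each other because [w a] squares to zero. *)
have EP : E * P = 1.
  rewrite -big_split /= big1 // => a _.
  have -> : (1 + (1 - t) * w a) * (1 + (t - 1) * w a) = 1 - (t - 1) ^+ 2 * w a ^+ 2 by ring.
  by rewrite w2 mulr0 subr0.
have -> : (1 - t * E) * G 0%N = G 0%N - E * (t * G 0%N) by ring.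
by rewrite tG mulrA EP; ring.
Qed.

(** * The transfer equation for generating functions *)

Definition truncs (F : series) N : {poly {poly rat}} := \poly_(i < N.+1) F i.
Definition exp_coef : series := fun k => ((k`!%:R : rat)^-1)%:P.

Lemma coef_truncs F N i : (i <= N)%N -> (truncs F N)`_i = F i.
Proof. by move=> iN; rewrite coef_poly ltnS iN. Qed.

Lemma truncs_comp F N (p : {poly {poly rat}}) :
  truncs F N \Po p = \sum_(k < N.+1) (F k)%:P * p ^+ k.
Proof.
rewrite /truncs poly_def raddf_sum /=; apply: eq_bigr => k _.
by rewrite comp_polyZ rmorphXn /= comp_polyX mul_polyC.
Qed.

Lemma egfK (P : nat -> {poly rat}) k : egf P k *+ k`! = P k.
Proof.
by rewrite /egf -scaler_nat scalerA divff ?scale1r // pnatr_eq0 -lt0n fact_gt0.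
Qed.

(** The recursion for [G] is the hypothesis of [descent_transfer] in the set algebra over ['I_N],
    and [egf_set] carries power series there. [N] labels suffice for the coefficients up to [N]:
    each [i <= N] is the size of a subset, and [i!] can be cancelled. *)
Lemma egf_descent_transfer N (q g : nat -> {poly rat})
    (G : nat -> {set 'I_N} -> {poly rat}) :
  (forall c S, G c S = (S == set0)%:R * 'X^(0 < c)%N +
     \sum_(a < N) \sum_(U : {set 'I_N} | (U \subset S) && (a \in U))
        'X^(a.+1 < c)%N * q #|U|.-1 * G a.+1 (S :\: U)) ->
  (forall S, G 0%N S = g #|S|) ->
  eqtrunc N
    ((1 - 'X%:P * (truncs exp_coef N \Po ((1 - 'X)%:P * ('X * truncs (egf q) N))))
      * truncs (egf g) N)
    (1 - 'X)%:P.
Proof.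
move=> GE G0.
pose A := set_alg 'I_N {poly rat}.
pose Phi : {rmorphism {poly {poly rat}} -> A} := @egf_set 'I_N {poly rat}.
pose t := Phi 'X%:P; pose w := @rooted_weight 'I_N {poly rat} q.
pose H c : A := [ffun S => G c S].
have HE c : H c = t ^+ (0 < c)%N + \sum_(a < N) t ^+ (a.+1 < c)%N * w a * H a.+1.
  apply/ffunP => S; rewrite set_algD set_alg_sum [LHS]ffunE GE; congr (_ + _).
    rewrite /t -rmorphXn -polyC_exp /= -[egf_set _ _]mulr1 egf_setC_mul set_alg1.
    exact: mulrC.
  apply: eq_bigr => a _; rewrite -mulrA /t -rmorphXn -polyC_exp /= egf_setC_mul.
  rewrite set_algM big_distrr /= big_mkcondr; apply: eq_bigr => U _.
  by rewrite !ffunE; case: (a \in U); rewrite ?mul1r ?mul0r ?mulr0 ?mulrA.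
have w2 a : w a ^+ 2 = 0 by apply: rooted_weight_sqr.
have := descent_transfer w2 HE.
have w2' a : ((1 - t) * w a) ^+ 2 = 0 by rewrite exprMn w2 mulr0.
pose iota : {rmorphism rat -> A} := (Phi \o (@polyC {poly rat}) \o (@polyC rat)).
have [_] := prod_1D_sqr0 iota (index_enum 'I_N) w2'.
have -> : size (index_enum 'I_N) = N by rewrite -[RHS]card_ord cardT enumT.
move=> ->.
have -> : \sum_(i <- index_enum 'I_N) (1 - t) * w i =
    Phi ((1 - 'X)%:P * ('X * truncs (egf q) N)).
  rewrite -big_distrr /= rmorphM polyCB rmorphB rmorph1; congr (_ * _).
  apply/ffunP => S; rewrite sum_rooted_weight egf_setE coefXM.
  have SN : (#|S| <= N)%N by rewrite -[X in (_ <= X)%N]card_ord max_card.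
  case: #|S| SN => [|m] mN; first by rewrite mulr0n.
  by rewrite /= coef_truncs ?(ltnW mN) // factS mulnC mulrnA egfK.
have -> : H 0%N = Phi (truncs (egf g) N).
  apply/ffunP => S; rewrite ffunE G0 egf_setE coef_truncs ?egfK //.
  by rewrite -[X in (_ <= X)%N]card_ord max_card.
set Y := _ * ('X * _).
have -> : \sum_(k < N.+1) iota (k`!%:R)^-1 * Phi Y ^+ k = Phi (truncs exp_coef N \Po Y).
  rewrite truncs_comp rmorph_sum /=; apply: eq_bigr => k _.
  by rewrite [RHS]rmorphM rmorphXn.
have -> : 1 - t = Phi (1 - 'X)%:P by rewrite polyCB rmorphB rmorph1.
rewrite -rmorphM -[X in X - _](rmorph1 Phi) -rmorphB -rmorphM => /ffunP E i iN.
(* Evaluation at a set of size [i] reads off coefficient [i], up to the factor [i!]. *)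
have [S Si] : exists S : {set 'I_N}, #|S| = i.
  exists [set x : 'I_N | (x < i)%N].
  rewrite -sum1_card; under eq_bigl => x do rewrite inE.
  by rewrite -(big_ord_widen N (fun=> 1%N) iN) sum1_card card_ord.
have := E S; rewrite !egf_setE Si => /eqP.
rewrite -subr_eq0 -mulrnBl -scaler_nat scaler_eq0 pnatr_eq0 -leqn0 leqNgt fact_gt0 /=.
by rewrite subr_eq0 => /eqP.
Qed.

(** * Descents and quasi-Stirling words *)

Section DescentPaths.
Local Open Scope nat_scope.
Implicit Types (s u v : seq nat).

(** Descents along the path from [c] through [s] to [e]. Prescribed end letters make the count
    additive when a word is cut at a letter. *)
Fixpoint dpath (c : nat) s (e : nat) : nat :=
  if s is x :: s' then (x < c) + dpath x s' e else (e < c).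

Lemma dpath_cat c u a v e : dpath c (u ++ a :: v) e = dpath c u a + dpath a v e.
Proof. by elim: u c => //= x u IH c; rewrite IH addnA. Qed.

(** For empty [s] the default 0 of [nth] gives the descent at the last index, because [x] is
    positive. *)
Lemma des_cons x s : 0 < x -> des (x :: s) = (nth 0 s 0 < x) + des s.
Proof.
move=> x0; rewrite /des /= big_ord_recl /=; congr (_ + _).
by case: s => [|y s] /=; rewrite ?x0 ?eqSS ?orbF.
Qed.

Lemma des_dpath s : all (ltn 0) s -> des s = dpath 0 s 0.
Proof.
case: s => [|x s] /=; first by rewrite /des big_ord0.
rewrite add0n; elim: s x => [|y s IH] x /andP[x0 sx].
  by rewrite des_cons //= x0 /des big_ord0.
by rewrite des_cons //= IH.
Qed.

Lemma dpath_mono (T : Type) (S : pred T) (f g : T -> nat) (w : seq T) :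
  (forall x y, S x -> S y -> (f x < f y) = (g x < g y)) ->
  (forall x, S x -> (0 < f x) = (0 < g x)) ->
  all S w -> dpath 0 (map f w) 0 = dpath 0 (map g w) 0.
Proof.
move=> fg fg0; case: w => [|x w] //=; rewrite !add0n.
elim: w x => [|y w IH] x /= /andP[Sx]; first by rewrite fg0.
by move=> /andP[Sy Sw]; rewrite fg // IH //= Sy.
Qed.

(** Moves the letters above [a] below those under [a], keeping the order within each group: when [K]
    bounds the letters, every [x + K] exceeds every [y - a]. *)
Definition rotate_above (K a x : nat) := if a < x then x - a else x + K.

(* Only the steps across [a] change status, and these changes telescope. *)
Lemma dpath_rotate K a u :
  all (fun x => [&& 0 < x, x <= K & x != a]) u ->
  dpath a u a = dpath 0 (map (rotate_above K a) u) 0.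
Proof.
case: u => [|x s] /=; first by rewrite ltnn.
set f := rotate_above K a; set Q := fun x => _.
(* The indicator of [a < x] at the current letter is the telescoping quantity; the [+ 1] matches the
   closing step to 0, which always descends. *)
have key : forall x, all Q (x :: s) ->
    dpath x s a + 1 = dpath (f x) (map f s) 0 + (a < x).
  elim: s => [|y s IH] z /= /andP[].
    rewrite /f /rotate_above => /and3P[z0 zK /eqP za] _; case: ltnP => h; lia.
  move=> Qz /= Qys; have := IH y Qys; move: Qys => /= /andP[Qy _].
  move: Qz Qy => /and3P[z0 zK /eqP za] /and3P[y0 yK /eqP ya].
  have : (y < z) + (a < y) = (f y < f z) + (a < z).
    by rewrite /f /rotate_above; case: (ltnP a y) => ?; case: (ltnP a z) => ?; lia.
  lia.
move=> Qxs; have := key x Qxs; move: Qxs => /andP[/and3P[x0 xK /eqP xa] _]; lia.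
Qed.

Lemma rotate_above_gt0 K a x : 0 < x -> 0 < rotate_above K a x.
Proof. by rewrite /rotate_above => x0; case: (ltnP a x) => ?; lia. Qed.

Lemma rotate_above_inj K a :
  {in [pred x | 0 < x <= K] &, injective (rotate_above K a)}.
Proof.
move=> x y; rewrite !inE /rotate_above => /andP[x0 xK] /andP[y0 yK].
by case: ltnP => ?; case: ltnP => ?; lia.
Qed.

End DescentPaths.

(** * Subsequences and crossings *)

Section Subsequences.
Variable T : eqType.
Implicit Types (s l u v w : seq T).

Lemma subseq_cons_dropP x0 x l s m :
  reflect (exists i, [/\ (m <= i)%N, (i < size s)%N, nth x0 s i = x &
                      subseq l (drop i.+1 s)])
          (subseq (x :: l) (drop m s)).
Proof.
apply: (iffP idP) => [|[i [mi si <- sl]]]; last first.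
  apply: (@subseq_trans _ (drop i s)).
    by rewrite (drop_nth x0) //= eqxx.
  by rewrite -(subnK mi) -drop_drop; apply: drop_subseq.
have [k] := ubnP (size s - m); elim: k m => // k IH m km.
case: (ltnP m (size s)) => ms; last by rewrite drop_oversize.
rewrite (drop_nth x0) //=; case: eqP => [-> h|_].
  by exists m; split.
case/IH => [|i [mi si nx sl]]; first by lia.
by exists i; split=> //; apply: ltnW.
Qed.

Lemma count_mem_gt0 x w : (0 < count_mem x w)%N = (x \in w).
Proof. by rewrite -has_count has_pred1. Qed.

(** The pattern condition of [no_1212] without indices, so that it passes directly to
    subsequences. *)
Definition noncrossing w := forall x y, ~~ subseq [:: x; y; x; y] w.

Lemma noncrossing_subseq u w : subseq u w -> noncrossing w -> noncrossing u.
Proof. by move=> uw nw x y; apply: contra (nw x y) => h; apply: subseq_trans uw. Qed.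

Lemma subseq2_cat x y u v :
  x \notin u -> y \notin v -> ~~ subseq [:: x; y] (u ++ v).
Proof.
elim: u => [|z u IH] /=.
  move=> _ yv; apply: contra yv => /mem_subseq; apply; by rewrite !inE eqxx orbT.
rewrite inE negb_or => /andP[/negbTE -> xu] yv; exact: IH.
Qed.

End Subsequences.

Lemma no_1212P s : reflect (noncrossing s) (no_1212 s).
Proof.
apply: (iffP idP) => [/forallP h x y|h].
  apply/negP; rewrite -[s]drop0.
  case/(subseq_cons_dropP 0%N) => i [_ si ix].
  case/(subseq_cons_dropP 0%N) => j [ij sj jy].
  case/(subseq_cons_dropP 0%N) => k [jk sk kx].
  case/(subseq_cons_dropP 0%N) => l [kl sl ly _].
  have /forallP/(_ (Ordinal sj))/forallP/(_ (Ordinal sk))/forallP/(_ (Ordinal sl)) :=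
    h (Ordinal si).
  by rewrite /= ij jk kl ix jy kx ly !eqxx.
apply/forallP => i; apply/forallP => j; apply/forallP => k; apply/forallP => l.
apply/negP => /and5P[ij jk kl /eqP ik /eqP jl].
have /negP := h (nth 0%N s i) (nth 0%N s j); apply; rewrite -[X in subseq _ X]drop0.
apply/(subseq_cons_dropP 0%N); exists i; split=> //.
apply/(subseq_cons_dropP 0%N); exists j; split=> //.
apply/(subseq_cons_dropP 0%N); exists k; split=> //.
by apply/(subseq_cons_dropP 0%N); exists l; split=> //; apply: sub0seq.
Qed.

(** * Block decomposition of quasi-Stirling words *)

Section QuasiStirlingWords.
Variable T : finType.
Implicit Types (S U : {set T}) (u v w : seq T) (a x y : T).

(** Only equality of letters matters here; their numerical order enters later through a map to
    [nat]. *)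
Definition qs_word S w :=
  (forall x, count_mem x w = (x \in S).*2) /\ noncrossing w.

Lemma qs_word_mem S w : qs_word S w -> w =i S.
Proof. by move=> [h _] x; rewrite -count_mem_gt0 h; case: (x \in S). Qed.

Lemma qs_word_nil S : qs_word S [::] <-> S = set0.
Proof.
split=> [/qs_word_mem h|->]; first by apply/setP => x; rewrite -h inE.
by split=> [x|x y] //; rewrite inE.
Qed.

(** A crossing cannot involve [a], whose two copies enclose [u], while [u] and [v] share no letter.
    A crossing without [a] lies in [u ++ v], hence in [u] or in [v] alone. *)
Lemma qs_word_block S U a u v : a \in U -> U \subset S ->
  qs_word (U :\ a) u -> qs_word (S :\: U) v -> qs_word S (a :: u ++ a :: v).
Proof.
move=> aU US qu qv; have um := qs_word_mem qu; have vm := qs_word_mem qv.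
have [cu nu] := qu; have [cv nv] := qv.
have au : a \notin u by rewrite um !inE eqxx.
have av : a \notin v by rewrite vm !inE aU.
have cw x : count_mem x (a :: u ++ a :: v) = (x \in S).*2.
  rewrite /= count_cat /= cu cv !inE; have [->|xa] := eqVneq x a.
    by rewrite aU (subsetP US a aU).
  rewrite /=.
  by have := subsetP US x; case: (x \in U); case: (x \in S) => // /(_ isT).
have uv x : x \in u -> x \notin v.
  by rewrite um vm !inE => /andP[_ ->].
split=> // x y; apply/negP => h.
have xy : x != y.
  apply: contraTneq h => ->; apply/negP => /(leq_count_subseq (pred1 y)).
  by rewrite cw /= eqxx; case: (y \in S).
have nyx := negbTE xy.
have hw z : z \in [:: x; y] -> [|| z == a, z \in u | z \in v].
  move=> zxy; have : z \in [:: x; y; x; y].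
    by move: zxy; rewrite !inE => /orP[]/eqP->; rewrite eqxx ?orbT.
  by move/(mem_subseq h); rewrite !(inE, mem_cat); case: (z == a); case: (z \in u).
have [/eqP xa|xa] := boolP (x == a).
  move: h; rewrite xa /= eqxx => h; rewrite xa in xy nyx hw.
  have := hw y; rewrite !inE eqxx orbT [y == a]eq_sym nyx /= => /(_ isT)/orP[yu|yv].
    have yav : y \notin a :: v by rewrite inE eq_sym nyx uv.
    by apply: (negP (subseq2_cat au yav)); apply: subseq_trans h; apply: subseq_cons.
  have := @subseq2_cat _ y a (rcons u a) v; rewrite mem_rcons inE eq_sym nyx /=.
  have -> : y \notin u by apply/negP => /uv; rewrite yv.
  move=> /(_ isT av) /negP; apply; rewrite cat_rcons.
  by apply: subseq_trans h; rewrite /= !eqxx.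
have [/eqP ya|ya] := boolP (y == a).
  move: h; rewrite ya /= [x == a](negbTE xa) => /(leq_count_subseq (pred1 a)).
  by rewrite count_cat /= !eqxx !(count_memPn _) // (negbTE xa).
have f : subseq [:: x; y; x; y] (u ++ v).
  have : subseq [:: x; y; x; y] (filter (predC1 a) (a :: u ++ a :: v)).
    by rewrite subseq_filter h andbT /= xa ya.
  rewrite /= filter_cat /= eqxx /=.
  by rewrite !(all_filterP _) //; apply/allP => z zz /=; apply: contraTneq zz => ->.
have hx : (x \in u) || (x \in v) by have := hw x; rewrite !inE eqxx (negbTE xa) => /(_ isT).
have hy : (y \in u) || (y \in v).
  by have := hw y; rewrite !inE eqxx orbT (negbTE ya) => /(_ isT).
have fil (P : pred T) : P x -> P y ->
    subseq [:: x; y; x; y] (filter P u ++ filter P v).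
  by move=> Px Py; rewrite -filter_cat subseq_filter f /= Px Py.
have fu : filter (mem u) u ++ filter (mem u) v = u.
  rewrite (all_filterP _); last by apply/allP.
  rewrite (eq_in_filter (a2 := pred0)) ?filter_pred0 ?cats0 // => z zv /=.
  by apply/negbTE/negP => /uv; rewrite zv.
have fv : filter (mem v) u ++ filter (mem v) v = v.
  rewrite [X in _ ++ X](all_filterP _); last by apply/allP.
  rewrite (eq_in_filter (a2 := pred0)) ?filter_pred0 // => z zu /=.
  exact/negbTE/uv.
case/orP: hx => hx; case/orP: hy => hy.
- by have /negP := nu x y; apply; rewrite -fu; apply: fil.
- have /negP := @subseq2_cat _ y x u v (contraL (@uv y) hy) (uv _ hx); apply.
  by apply: subseq_trans f; rewrite /= ?[y == x]eq_sym ?nyx !eqxx.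
- have /negP := @subseq2_cat _ x y u v (contraL (@uv x) hx) (uv _ hy); apply.
  by apply: subseq_trans f; rewrite /= !eqxx.
- by have /negP := nv x y; apply; rewrite -fv; apply: fil.
Qed.

(** [a] is the first letter and [u] ends at its second copy; a letter [x] common to [u] and [v]
    would give the crossing a x a x. [U] collects [a] and the letters of [u]. *)
Lemma qs_word_split S w : qs_word S w -> w != [::] ->
  exists a U u v, [/\ w = a :: u ++ a :: v, a \in U, U \subset S,
    qs_word (U :\ a) u & qs_word (S :\: U) v].
Proof.
case: w => // a r qw _; have [cw nw] := qw; have wm := qs_word_mem qw.
have aS : a \in S by rewrite -wm inE eqxx.
have ar : a \in r.
  by rewrite -count_mem_gt0; have := cw a; rewrite /= eqxx aS; lia.
case/splitPr: ar qw cw nw wm => u v qw cw nw wm.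
have /eqP : (count_mem a u + count_mem a v = 0)%N.
  by have := cw a; rewrite aS /= count_cat /= eqxx !add1n addnS => -[].
rewrite addn_eq0 => /andP[/eqP/count_memPn au /eqP/count_memPn av].
have uv x : x \in u -> x \notin v.
  move=> xu; apply/negP => xv; have /negP := nw a x; apply.
  rewrite /= eqxx -[[:: x; a; x]]/([:: x] ++ [:: a; x]).
  by apply: cat_subseq; rewrite /= ?eqxx ?sub1seq.
have cx x : x != a -> (count_mem x u + count_mem x v = (x \in S).*2)%N.
  by move=> xa; rewrite -cw /= count_cat /= [a == x]eq_sym (negbTE xa) add0n.
exists a, (a |: [set x in u]), u, v; split=> //.
- by rewrite !inE eqxx.
- apply/subsetP => x; rewrite -wm !(inE, mem_cat) => /orP[->//|->].
  by rewrite orbT.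
- split; last first.
    apply: noncrossing_subseq nw; apply: subseq_trans (subseq_cons _ _).
    exact: prefix_subseq.
  move=> x; rewrite !inE; have [->|xa] := eqVneq x a.
    by apply/count_memPn.
  have [xu|/count_memPn //] := boolP (x \in u).
  have := cx x xa; rewrite [count_mem x v](count_memPn _) ?uv // addn0 => ->.
  by rewrite -wm !(inE, mem_cat) xu /= orbT.
- split; last first.
    apply: noncrossing_subseq nw; apply: subseq_trans (subseq_cons _ _).
    apply: subseq_trans (suffix_subseq _ _); exact: subseq_cons.
  move=> x; rewrite !inE; have [->|xa] := eqVneq x a.
    by apply/count_memPn.
  have [xu|/count_memPn xu] := boolP (x \in u); first by apply/count_memPn/uv.
  by rewrite -cx // xu.
Qed.

(** [m] bounds the recursion depth; the list is complete once [#|S| <= m]. The pair [z] holds the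
    label and the letter set of the first block. *)
Fixpoint qs_words (m : nat) S : seq (seq T) :=
  nseq (S == set0) [::] ++
  if m is m'.+1 then
    [seq z.1 :: uv.1 ++ z.1 :: uv.2 |
      z <- enum [pred z : T * {set T} | (z.2 \subset S) && (z.1 \in z.2)],
      uv <- [seq (u, v) | u <- qs_words m' (z.2 :\ z.1), v <- qs_words m' (S :\: z.2)]]
  else [::].

Lemma qs_words_sound m S w : w \in qs_words m S -> qs_word S w.
Proof.
have base S' w' : w' \in nseq (S' == set0) [::] -> qs_word S' w'.
  rewrite mem_nseq; case: eqP => // -> /eqP ->; exact/qs_word_nil.
elim: m S w => [|m IH] S w /=; first by rewrite cats0; apply: base.
rewrite mem_cat => /orP[/base //|/allpairsPdep[[a U] [[u' v'] [zP]]]].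
move: zP; rewrite mem_enum inE /= => /andP[US aU] /allpairsP[[u v] /= [uq vq [-> ->]]] ->.
by apply: qs_word_block US _ _ => //; apply: IH.
Qed.

Lemma qs_words_complete m S w : (#|S| <= m)%N -> qs_word S w -> w \in qs_words m S.
Proof.
elim: m S w => [|m IH] S w Sm qw.
  have S0 : S = set0 by apply/cards0_eq/eqP; rewrite -leqn0.
  rewrite /= cats0 S0 eqxx /= inE; case: w qw => // x w /qs_word_mem /(_ x).
  by rewrite S0 !inE eqxx.
rewrite /= mem_cat; have [w0|w0] := eqVneq w [::].
  by move: qw; rewrite w0 => /qs_word_nil ->; rewrite eqxx inE.
have [a [U [u [v [-> aU US qu qv]]]]] := qs_word_split qw w0.
apply/orP; right; apply/allpairsPdep; exists (a, U), (u, v); split=> //=.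
  by rewrite mem_enum inE /= US aU.
have US' := subset_leq_card US.
have cU : #|U| = #|U :\ a|.+1 by rewrite (cardsD1 a) aU.
have cS : #|S :\: U| = (#|S| - #|U|)%N by rewrite cardsD (setIidPr US).
by apply: allpairs_f; apply: IH => //; lia.
Qed.

(** The decomposition is determined by the word: [a] is its first letter, the next [a] separates [u]
    from [v], and [U] is recovered from [a] and [u]. *)
Lemma qs_words_uniq m S : uniq (qs_words m S).
Proof.
elim: m S => [|m IH] S; first by rewrite /= cats0; case: eqP.
rewrite [qs_words _ _]/= cat_uniq; apply/and3P; split.
- by case: eqP.
- apply/hasPn => w /allpairsPdep[z [uv [_ _ ->]]].
  by rewrite mem_nseq; case: eqP.
apply: allpairs_uniq_dep; first exact: enum_uniq.
  move=> z _; apply: allpairs_uniq => //.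
  by move=> [? ?] [? ?] _ _ [-> ->].
move=> [z1 [u1 v1]] [z2 [u2 v2]].
case/allpairsPdep => -[a U] [[u v] [zP uvP E1]].
move: E1 => /eqP; rewrite -tag_eqE /tag_eq /= => /andP[/eqP -> ]; rewrite tagged_asE => /eqP[-> ->].
case/allpairsPdep => -[a' U'] [[u' v'] [zP' uvP' E2]].
move: E2 => /eqP; rewrite -tag_eqE /tag_eq /= => /andP[/eqP -> ]; rewrite tagged_asE => /eqP[-> ->].
have um : u =i U :\ a.
  by case/allpairsP: uvP => [[? ?] [/qs_words_sound/qs_word_mem h _ [-> _]]].
have um' : u' =i U' :\ a'.
  by case/allpairsP: uvP' => [[? ?] [/qs_words_sound/qs_word_mem h _ [-> _]]].
move=> /=; move: zP zP'; rewrite !mem_enum !inE /= => /andP[_ aU] /andP[_ aU'] [aa E].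
subst a'.
have au : a \notin u by rewrite um !inE eqxx.
have au' : a \notin u' by rewrite um' !inE eqxx.
have uu : u = u' /\ v = v'.
  elim: u u' au au' E {um um' uvP uvP'} => [|x u IHu] [|x' u'] //=.
  - by move=> _ _ [->].
  - by rewrite inE negb_or => _ /andP[/eqP ax _] [].
  - by rewrite inE negb_or => /andP[/eqP ax _] _ [/esym].
  rewrite !inE !negb_or => /andP[_ au] /andP[_ au'] [-> /IHu].
  by case=> // -> ->.
case: uu => uE vE; subst u' v'.
have -> // : U' = U.
apply/setP => x; have := um x; rewrite um' !inE.
by have [->|] := eqVneq x a; rewrite ?aU ?aU' //= => _ ->.
Qed.

Lemma perm_qs_words m m' S : (#|S| <= m)%N -> (#|S| <= m')%N ->
  perm_eq (qs_words m S) (qs_words m' S).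
Proof.
move=> Sm Sm'; apply: uniq_perm; rewrite ?qs_words_uniq // => w.
by apply/idP/idP => /qs_words_sound; apply: qs_words_complete.
Qed.

Lemma sum_qs_wordsS (V : pzSemiRingType) m S (F : seq T -> V) :
  \sum_(w <- qs_words m.+1 S) F w = (S == set0)%:R * F [::] +
  \sum_a \sum_(U : {set T} | (U \subset S) && (a \in U))
    \sum_(u <- qs_words m (U :\ a)) \sum_(v <- qs_words m (S :\: U)) F (a :: u ++ a :: v).
Proof.
rewrite [qs_words _ _]/= big_cat /=; congr (_ + _).
  by case: eqP => _; rewrite ?big_seq1 ?big_nil ?mul1r ?mul0r.
rewrite big_allpairs_dep pair_big_dep big_enum /=.
by apply: eq_bigr => z _; rewrite big_allpairs.
Qed.

End QuasiStirlingWords.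

(** * Standardisation of labels *)

Section Ranks.
Variables (T : finType) (S : {set T}) (r : T -> nat).
Hypothesis r_inj : {in S &, injective r}.
Hypothesis r_gt0 : {in S, forall x, (0 < r x)%N}.

(** On [S], the position of [r x] among the values of [r], counted from 1. *)
Definition rank_in (x : T) : nat := #|[set y in S | (r y <= r x)%N]|.

Lemma rank_in_lt x y : x \in S -> y \in S ->
  (rank_in x < rank_in y)%N = (r x < r y)%N.
Proof.
move=> xS yS.
have mono z z' : (r z <= r z')%N -> (rank_in z <= rank_in z')%N.
  move=> zz; apply: subset_leq_card; apply/subsetP => y'; rewrite !inE => /andP[->].
  by move/leq_trans; apply.
have [lt|le] := ltnP (r x) (r y); last by apply/negbTE; rewrite -leqNgt mono.
apply: proper_card; apply/properP; split.
  apply/subsetP => y'; rewrite !inE => /andP[->] h; exact: leq_trans h (ltnW lt).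
by exists y; rewrite !inE yS /= ?leqnn // -ltnNge.
Qed.

Lemma rank_in_inj : {in S &, injective rank_in}.
Proof.
move=> x y xS yS e; apply: r_inj => //; apply/eqP.
rewrite eqn_leq leqNgt -(rank_in_lt yS xS) e ltnn.
by rewrite leqNgt -(rank_in_lt xS yS) e ltnn.
Qed.

Lemma rank_in_gt0 x : x \in S -> (0 < rank_in x)%N.
Proof. by move=> xS; apply/card_gt0P; exists x; rewrite inE xS leqnn. Qed.

Lemma rank_in_le x : (rank_in x <= #|S|)%N.
Proof. by apply: subset_leq_card; apply/subsetP => y; rewrite inE => /andP[]. Qed.

Lemma map_rank_in_uniq : uniq (map rank_in (enum S)).
Proof.
rewrite map_inj_in_uniq ?enum_uniq // => x y; rewrite !mem_enum; exact: rank_in_inj.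
Qed.

Lemma mem_map_rank_in : map rank_in (enum S) =i iota 1 #|S|.
Proof.
apply: (uniq_min_size map_rank_in_uniq _ _).2.
  move=> k /mapP[x]; rewrite mem_enum => xS ->.
  by rewrite mem_iota rank_in_gt0 //= add1n ltnS rank_in_le.
by rewrite size_iota size_map -cardE.
Qed.

Lemma dpath_rank_in w : {subset w <= S} ->
  dpath 0 (map r w) 0 = des (map rank_in w).
Proof.
move=> wS; rewrite des_dpath; last first.
  by apply/allP => k /mapP[x /wS xS ->]; apply: rank_in_gt0.
apply: (@dpath_mono _ (mem S)).
- by move=> x y xS yS; rewrite rank_in_lt.
- by move=> x xS; rewrite r_gt0 // rank_in_gt0.
- exact/allP.
Qed.

Lemma map_rank_in_surj s : {subset s <= iota 1 #|S|} ->
  exists2 w, {subset w <= S} & s = map rank_in w.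
Proof.
elim: s => [|k s IH] h; first by exists [::].
have [|w wS ->] := IH; first by move=> j js; apply: h; rewrite inE js orbT.
have := h k; rewrite inE eqxx -mem_map_rank_in => /(_ isT)/mapP[x].
rewrite mem_enum => xS ->; exists (x :: w) => // y.
by rewrite inE => /orP[/eqP ->|/wS].
Qed.

Lemma map_rank_in_seq_inj w w' : {subset w <= S} -> {subset w' <= S} ->
  map rank_in w = map rank_in w' -> w = w'.
Proof.
elim: w w' => [|x w IH] [|x' w'] //= h h' [e /IH ->].
- by rewrite (rank_in_inj (h _ (mem_head _ _)) (h' _ (mem_head _ _)) e).
- by move=> y yw; apply: h; rewrite inE yw orbT.
- by move=> y yw; apply: h'; rewrite inE yw orbT.
Qed.

Lemma count_map_rank_in w x : {subset w <= S} -> x \in S ->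
  count_mem (rank_in x) (map rank_in w) = count_mem x w.
Proof.
move=> wS xS; rewrite count_map; apply: eq_in_count => y /wS yS /=.
by apply/eqP/eqP => [/rank_in_inj->|->].
Qed.

Lemma noncrossing_map_rank_in w : {subset w <= S} ->
  noncrossing (map rank_in w) <-> noncrossing w.
Proof.
move=> wS; split=> nw x y; apply/negP => h.
  by have /negP := nw (rank_in x) (rank_in y); apply; exact: (map_subseq rank_in h).
have mx : x \in map rank_in w by apply: (mem_subseq h); rewrite inE eqxx.
have my : y \in map rank_in w by apply: (mem_subseq h); rewrite !inE eqxx orbT.
case/mapP: mx h => x' x'w ->; case/mapP: my => y' y'w -> h.
have /negP := nw x' y'; apply; case/subseqP: h => m; rewrite size_map => sm.
rewrite -map_mask -[LHS]/(map rank_in [:: x'; y'; x'; y']) => /map_rank_in_seq_inj ->.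
- exact: mask_subseq.
- by move=> z; rewrite !inE => /or4P[]/eqP->; apply: wS.
- by move=> z /mem_mask /wS.
Qed.

End Ranks.

(** * The functional equation for quasi-Stirling permutations *)

Lemma count_stirling_multiset n k :
  count_mem k (stirling_multiset n) = (0 < k <= n)%N.*2.
Proof.
rewrite /stirling_multiset count_flatten -map_comp.
rewrite (eq_map (g := fun i => (i == k).*2)); last first.
  by move=> i /=; rewrite addn0 -addnn.
have -> : forall l, sumn [seq (i == k).*2 | i <- l] = (count_mem k l).*2.
  by elim=> //= i l ->; rewrite doubleD.
by rewrite count_uniq_mem ?iota_uniq // mem_iota add1n ltnS.
Qed.

Lemma quasi_stirlingP n s :
  reflect ((forall k, count_mem k s = (0 < k <= n)%N.*2) /\ noncrossing s)
          (quasi_stirling n s).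
Proof.
apply: (iffP andP) => [[/seq.permP p /no_1212P h]|[c /no_1212P h]]; split=> //.
  by move=> k; rewrite p count_stirling_multiset.
by apply/allP => k _ /=; rewrite c count_stirling_multiset.
Qed.

Lemma quasi_stirling_size n s : quasi_stirling n s -> size s = (2 * n)%N.
Proof.
case/andP => /perm_size -> _; rewrite /stirling_multiset size_flatten /shape -map_comp.
have sum2 (l : seq nat) : sumn [seq (size \o (fun i => [:: i; i])) i | i <- l] = (2 * size l)%N.
  by elim: l => //= i l ->; rewrite mulnS.
by rewrite sum2 size_iota.
Qed.

Lemma quasi_stirling_subset n s : quasi_stirling n s -> {subset s <= iota 1 n}.
Proof.
case/quasi_stirlingP => c _ k; rewrite -count_mem_gt0 c mem_iota add1n ltnS.
by case: (0 < k <= n)%N.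
Qed.

(** Standardisation is a descent-preserving bijection onto quasi-Stirling permutations of size
    [#|S|], so the sum does not depend on the labelling [r]. This freedom admits rotated labels. *)
Lemma sum_qs_words_Qbar (T : finType) m (S : {set T}) (r : T -> nat) :
  (#|S| <= m)%N -> {in S &, injective r} -> {in S, forall x, (0 < r x)%N} ->
  \sum_(w <- qs_words m S) 'X^(dpath 0 (map r w) 0) = Qbar #|S|.
Proof.
move=> Sm r_inj r_gt0; set n := #|S|; pose g := rank_in S r.
have sub w : w \in qs_words m S -> {subset w <= S}.
  by move/qs_words_sound/qs_word_mem => h x; rewrite h.
transitivity (\sum_(s <- map (map g) (qs_words m S)) ('X^(des s) : {poly rat})).
  rewrite big_map big_seq [RHS]big_seq; apply: eq_bigr => w /sub wS.
  by rewrite (dpath_rank_in r_gt0).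
pose P := [pred w : (2 * n).-tuple 'I_n.+1 | quasi_stirling n (map val w)].
have -> : Qbar n = \sum_(s <- [seq map val w | w : (2 * n).-tuple 'I_n.+1 in P]) 'X^(des s).
  by rewrite big_map big_enum.
apply: perm_big; apply: uniq_perm.
- rewrite map_inj_in_uniq ?qs_words_uniq // => w w' /sub wS /sub w'S.
  exact: map_rank_in_seq_inj.
- rewrite map_inj_uniq ?enum_uniq // => w w' /(inj_map val_inj) e; exact: val_inj.
move=> s.
have -> : (s \in [seq map val w | w : (2 * n).-tuple 'I_n.+1 in P]) = quasi_stirling n s.
  apply/mapP/idP => [[w]|qs]; first by rewrite mem_enum => wP ->.
  have sz : size (map (@inord n) s) == (2 * n)%N.
    by rewrite size_map (quasi_stirling_size qs).
  have e : s = map val (Tuple sz).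
    rewrite /= -map_comp -[LHS]map_id; apply/eq_in_map => k.
    move/(quasi_stirling_subset qs); rewrite mem_iota add1n => /andP[_ kn] /=.
    by rewrite inordK.
  by exists (Tuple sz) => //; rewrite mem_enum inE -e.
have imS k : (0 < k <= n)%N = (k \in map g (enum S)).
  by rewrite mem_map_rank_in // mem_iota add1n ltnS.
apply/mapP/idP => [[w wq ->]|qs].
  have wS := sub _ wq; have [cw nw] := qs_words_sound wq.
  apply/quasi_stirlingP; split; last exact/noncrossing_map_rank_in.
  move=> k; rewrite imS; have [/mapP[x]|kn] := boolP (k \in map g (enum S)).
    by rewrite mem_enum => xS ->; rewrite count_map_rank_in // cw xS.
  apply/count_memPn; apply: contra kn => /mapP[x /wS xS ->].
  by rewrite map_f // mem_enum.
have [w wS sE] := map_rank_in_surj r_inj (quasi_stirling_subset qs).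
exists w => //; apply: qs_words_complete => //.
move: qs => /quasi_stirlingP; rewrite sE => -[c /(noncrossing_map_rank_in r_inj wS) nw].
split=> // x; have [xS|xS] := boolP (x \in S); last first.
  by apply/count_memPn; apply: contra xS; apply: wS.
by rewrite -(count_map_rank_in r_inj wS xS) c imS map_f ?mem_enum.
Qed.

Lemma Qbar_functional_eq N :
  eqtrunc N
    ((1 - 'X%:P * (truncs exp_coef N \Po ((1 - 'X)%:P * ('X * truncs Qser N))))
      * truncs Qser N)
    (1 - 'X)%:P.
Proof.
pose r (i : 'I_N) := i.+1.
have cS (S : {set 'I_N}) : (#|S| <= N)%N by rewrite -[X in (_ <= X)%N]card_ord max_card.
apply: (@egf_descent_transfer N Qbar Qbar
  (fun c S => \sum_(w <- qs_words N S) 'X^(dpath c (map r w) 0))).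
  (* Raising the depth bound by one exposes the first block. *)
  move=> c S; rewrite (perm_big _ (perm_qs_words (cS S) (leqW (cS S)))).
  rewrite sum_qs_wordsS /=; congr (_ + _).
  apply: eq_bigr => a _; apply: eq_bigr => U /andP[US aU].
  (* Within a block the path starts and ends at [a.+1]; rotation turns it into a path from 0 to 0,
     counted by [Qbar]. *)
  pose f := rotate_above N a.+1.
  have -> : Qbar #|U|.-1 = \sum_(u <- qs_words N (U :\ a)) 'X^(dpath a.+1 (map r u) a.+1).
    rewrite (cardsD1 a) aU add1n /= -(@sum_qs_words_Qbar _ N _ (f \o r)) //.
    - rewrite big_seq [RHS]big_seq; apply: eq_bigr => u /qs_words_sound/qs_word_mem um.
      rewrite (@dpath_rotate N a.+1); first (by rewrite -map_comp); apply/allP => k /mapP[x].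
      by rewrite um !inE => /andP[xa _] ->; rewrite /r ltn_ord eqSS.
    - move=> x y _ _ /rotate_above_inj e; apply/val_inj/succn_inj/e; rewrite inE /r /=; exact: ltn_ord.
    - by move=> x _; apply: rotate_above_gt0.
  rewrite -mulrA mulr_suml mulr_sumr; apply: eq_bigr => u _.
  rewrite !mulr_sumr; apply: eq_bigr => v _.
  by rewrite map_cat /= dpath_cat !exprD mulrA.
move=> S; apply: sum_qs_words_Qbar => //.
by move=> x y _ _ /succn_inj/val_inj.
Qed.

(** * The functional equation for Eulerian polynomials *)

Lemma sum_permutations_eulerian (T : finType) (S : {set T}) (r : T -> nat) :
  {in S &, injective r} -> {in S, forall x, (0 < r x)%N} ->
  \sum_(w <- permutations (enum S)) 'X^(dpath 0 (map r w) 0) = eulerian #|S|.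
Proof.
move=> r_inj r_gt0; set n := #|S|; pose g := rank_in S r.
have sub w : w \in permutations (enum S) -> {subset w <= S}.
  by rewrite mem_permutations => /perm_mem h x; rewrite h mem_enum.
transitivity (\sum_(s <- permutations (iota 1 n)) ('X^(des s) : {poly rat})).
  transitivity (\sum_(s <- map (map g) (permutations (enum S))) ('X^(des s) : {poly rat})).
    rewrite big_map big_seq [RHS]big_seq; apply: eq_bigr => w /sub wS.
    by rewrite (dpath_rank_in r_gt0).
  have gE : perm_eq (map g (enum S)) (iota 1 n).
    by apply: uniq_perm; rewrite ?iota_uniq ?map_rank_in_uniq //; apply: mem_map_rank_in.
  have u1 : uniq (map (map g) (permutations (enum S))).
    rewrite map_inj_in_uniq ?permutations_uniq // => w w' /sub wS /sub w'S.
    exact: map_rank_in_seq_inj.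
  apply: perm_big; apply: uniq_perm; rewrite ?permutations_uniq //.
  (* An inclusion of duplicate-free lists of equal length, here [n!], is an equality of sets. *)
  apply: (uniq_min_size u1 _ _).2.
    move=> s /mapP[w]; rewrite !mem_permutations => wp ->.
    by apply: perm_trans gE; apply: perm_map.
  by rewrite size_map !size_permutations ?iota_uniq ?enum_uniq // size_iota -cardE.
pose h (s : {perm 'I_n}) := [seq (val (s i)).+1 | i <- enum 'I_n].
have -> : eulerian n = \sum_(s <- map h (enum {perm 'I_n})) 'X^(des s).
  by rewrite big_map big_enum.
have iE : iota 1 n = [seq (val i).+1 | i <- enum 'I_n].
  by rewrite (map_comp succn) val_enum_ord -(iotaDl 1 0 n).
have u1 : uniq (map h (enum {perm 'I_n})).
  rewrite map_inj_uniq ?enum_uniq // => s s' /eq_in_map e.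
  by apply/permP => i; apply/val_inj/succn_inj/e; rewrite mem_enum.
apply: perm_big; rewrite perm_sym; apply: uniq_perm; rewrite ?permutations_uniq //.
apply: (uniq_min_size u1 _ _).2.
  move=> l /mapP[s _ ->]; rewrite mem_permutations iE.
  have -> : h s = map (succn \o val) (map s (enum 'I_n)) by rewrite -map_comp.
  apply: perm_map; apply: uniq_perm; rewrite ?(map_inj_uniq perm_inj) ?enum_uniq //.
  by move=> i; rewrite mem_enum -[i](permKV s) mem_map ?mem_enum //; apply: perm_inj.
rewrite size_map size_permutations ?iota_uniq // size_iota -cardE.
by rewrite card_Sn.
Qed.

(** A permutation corresponds to a word whose blocks all have empty interior, so [q] is 1 at 0 and 0
    elsewhere, and its generating function is 1. *)
Lemma eulerian_functional_eq N :
  eqtrunc N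
    ((1 - 'X%:P * (truncs exp_coef N \Po ((1 - 'X)%:P * 'X))) * truncs Aser N)
    (1 - 'X)%:P.
Proof.
pose r (i : 'I_N) := i.+1; pose q k : {poly rat} := (k == 0%N)%:R.
have q1 : truncs (egf q) N = 1.
  apply/polyP => i; rewrite coef_poly coef1 /egf /q.
  by case: i => [|i]; rewrite ?fact0 ?invr1 ?scale1r // scaler0 if_same.
have := @egf_descent_transfer N q eulerian
  (fun c S => \sum_(w <- permutations (enum S)) 'X^(dpath c (map r w) 0)).
rewrite q1 mulr1; apply; last first.
  by move=> S; apply: sum_permutations_eulerian => // x y _ _ /succn_inj/val_inj.
move=> c S; have [->|S0] := eqVneq S set0.
  rewrite enum_set0 big_seq1 mul1r /= big1 ?addr0 // => a _.
  by rewrite big_pred0 // => U; rewrite subset0; case: eqP => //= ->; rewrite inE.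
have sz : (0 < size (enum S))%N by rewrite -cardE card_gt0.
rewrite (perm_big _ (permutationsE sz)) big_allpairs_dep undup_id ?enum_uniq //.
rewrite mul0r add0r big_enum big_mkcond /=; apply: eq_bigr => a _.
have [aS|aS] := boolP (a \in S); last first.
  rewrite big_pred0 // => U; apply/negbTE/negP => /andP[/subsetP US /US].
  by rewrite (negbTE aS).
(* The factor [q] leaves only the block with letter set [[set a]]. *)
rewrite (bigD1 [set a]) /=; last by rewrite sub1set aS inE eqxx.
rewrite cards1 mulr1 [X in _ = _ + X]big1 ?addr0; last first.
  move=> U /andP[/andP[US aU] Ua]; rewrite /q; case: eqP => [cU|]; last by rewrite mulr0 mul0r.
  case/eqP: Ua; apply/eqP; rewrite eq_sym eqEcard sub1set aU cards1 /=.
  by move: cU; case: #|U| => [|[|]].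
rewrite mulr_sumr.
have pe : perm_eq (permutations (rem a (enum S))) (permutations (enum (S :\ a))).
  apply: perm_permutations; apply: uniq_perm; rewrite ?rem_uniq ?enum_uniq //.
  by move=> x; rewrite mem_rem_uniq ?enum_uniq // !inE !mem_enum !inE.
rewrite (perm_big _ pe) /=; apply: eq_bigr => w _.
by rewrite exprD.
Qed.

(** * From truncated polynomials back to power series *)

Section Agreement.
Variable N : nat.
Implicit Types (p q : {poly {poly rat}}) (F G : series).

Definition agree p F := forall i, (i <= N)%N -> p`_i = F i.

Lemma agree_truncs F : agree (truncs F N) F.
Proof. by move=> i; apply: coef_truncs. Qed.

Lemma agreeM p q F G : agree p F -> agree q G -> agree (p * q) (smul F G).
Proof.
move=> h1 h2 i hi; rewrite coefM; apply: eq_bigr => j _.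
by rewrite h1 ?h2 //; move: (ltn_ord j); lia.
Qed.

Lemma agreeX p F k : agree p F -> agree (p ^+ k) (spow F k).
Proof.
move=> h; elim: k => [|k IH]; last by rewrite exprS; apply: agreeM.
by move=> i _; rewrite coef1.
Qed.

Lemma agree_comp p q F G :
  q`_0 = 0 -> agree p F -> agree q G -> agree (p \Po q) (scomp F G).
Proof.
move=> q0 h1 h2 i hi; rewrite coef_comp_trunc //; apply: eq_bigr => k _.
by rewrite h1 ?(agreeX k h2) //; move: (ltn_ord k); lia.
Qed.

Lemma agree_szmul p F : agree p F -> agree ('X * p) (szmul F).
Proof. by move=> h [|i] hi; rewrite coefXM //= h // ltnW. Qed.

Lemma agree_sscale c p F : agree p F -> agree (c%:P * p) (sscale c F).
Proof. by move=> h i hi; rewrite coefCM h. Qed.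

End Agreement.

(** * Comparison of the two equations and coefficient extraction *)

Lemma subX_lreg : GRing.lreg (1 - 'X : {poly rat}).
Proof.
apply/lregP; rewrite subr_eq0 eq_sym; apply/eqP => /(congr1 (coefp 0)) /=.
by rewrite coefX coefC.
Qed.

Lemma coef0_kernel N (Y : {poly {poly rat}}) : Y`_0 = 0 ->
  (1 - 'X%:P * (truncs exp_coef N \Po Y))`_0 = 1 - 'X.
Proof.
move=> Y0; rewrite coefB coef1 coefCM coef_comp_trunc // big_ord1 coef_truncs //.
by rewrite expr0 coef1 /= /exp_coef fact0 invr1 !mulr1.
Qed.

(** Substituting zQ for z in the Eulerian equation yields the same factor 1 - t exp((1-t)zQ) as in
    the equation for Q. Its constant term [1 - 'X] is regular, so it cancels. *)
Lemma Qser_eq_comp N :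
  eqtrunc N (truncs Qser N) (truncs Aser N \Po ('X * truncs Qser N)).
Proof.
set Q := truncs Qser N; set A := truncs Aser N.
have XQ0 : ('X * Q)`_0 = 0 by rewrite coefXM.
pose Y := (1 - 'X)%:P * ('X * Q).
have Y0 : Y`_0 = 0 by rewrite coefCM XQ0 mulr0.
apply: (@eqtrunc_regI _ _ _ _ (1 - 'X%:P * (truncs exp_coef N \Po Y))).
  by rewrite coef0_kernel //; apply: subX_lreg.
apply: eqtrunc_trans (@Qbar_functional_eq N) _.
have := eqtrunc_comp XQ0 (@eulerian_functional_eq N).
rewrite comp_polyC comp_polyM comp_polyB comp_polyM -comp_polyA comp_polyM.
rewrite !comp_polyC comp_polyX => h; exact: eqtrunc_sym.
Qed.

Lemma Qser0 : Qser 0 = 1.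
Proof.
have := Qbar_functional_eq (leqnn 0); rewrite coef0M coef0_kernel ?coefCM ?coefXM ?mulr0 //.
by rewrite coefC /= coef_truncs // -[RHS in _ = RHS]mulr1 => /subX_lreg.
Qed.

Theorem theorem2p3 :
  (* Q(t,z) = A(t, z Q(t,z)) *)
  (forall n : nat, Qser n = scomp Aser (szmul Qser) n)
  (* Q(t,z) (1 - t e^{(1-t) z Q(t,z)}) = 1 - t *)
  /\ (forall n : nat,
        smul (fun m => sone m - 'X * sexp (sscale (1 - 'X) (szmul Qser)) m) Qser n
        = (if n == 0%N then 1 - 'X else 0))
  (* Q_n(t) = n!/(n+1) [z^n] A(t,z)^{n+1} *)
  /\ (forall n : nat,
        Qbar n = ((n`!%:R : rat) / (n.+1)%:R) *: spow Aser n.+1 n).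
Proof.
have XQ0 n : ('X * truncs Qser n)`_0 = 0 by rewrite coefXM.
have aQ n : agree n (truncs Qser n) Qser := @agree_truncs n Qser.
split; [|split] => n.
- have := Qser_eq_comp (leqnn n); rewrite coef_truncs // => ->.
  by apply: agree_comp (leqnn n) => //; [apply: agree_truncs|apply: agree_szmul].
- have := Qbar_functional_eq (leqnn n); rewrite coefC => <-; symmetry.
  apply: agreeM (leqnn n) => // i hi; rewrite coefB coef1 coefCM; congr (_ - _ * _).
  apply: agree_comp hi; first by rewrite coefCM XQ0 mulr0.
    exact: agree_truncs.
  by apply: agree_sscale; apply: agree_szmul.
(* Lagrange inversion needs a torsion-free coefficient ring; here rational scalars provide it. *)
- have inj m : (0 < m)%N -> injective (fun x : {poly rat} => x *+ m).
    move=> m0 x y /= e; apply: (@scalerI _ _ m%:R); first by rewrite pnatr_eq0 -lt0n.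
    by rewrite !scaler_nat.
  have := lagrange_inversion inj (_ : (truncs Qser n)`_0 = 1) (@Qser_eq_comp n).
  rewrite !coef_truncs // => /(_ Qser0).
  rewrite (agreeX n.+1 (@agree_truncs n Aser)) // => <-.
  rewrite -[in LHS](egfK Qbar n) -/(Qser n) -[Qser n *+ n.+1]scaler_nat scalerA.
  by rewrite mulfVK ?pnatr_eq0 // scaler_nat.
Qed.
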